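(* Let $F$ be a field of characteristic zero, $V=F^n$, $A\subseteq M_n(F)$ a semisimple subalgebra containing the identity, and $\mathcal G$ the group of units of the centralizer $End_A(V)=\{g\in M_n(F): ga=ag\ \forall a\in A\}$. Then every polynomial function $f:M_n(F)^k\to F$ invariant under simultaneous conjugation by $\mathcal G$ (i.e. $f(gx_1g^{-1},\dots,gx_kg^{-1})=f(x_1,\dots,x_k)$ for all $g\in\mathcal G$) is given by a pure $A$-trace polynomial; that is, the algebra of such invariant functions is generated by the functions $(x_1,\dots,x_k)\mapsto tr(a_1x_{i_1}a_2x_{i_2}\cdots a_mx_{i_m})$ with $a_j\in A$ and $1\le i_j\le k$. *)

(* Defs.v *)
From HB Require Import structures.
From mathcomp Require Import all_boot all_order all_algebra.
Set Implicit Arguments. Unset Strict Implicit. Unset Printing Implicit Defensive.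
Import Order.TTheory GRing.Theory Num.Theory.
Local Open Scope ring_scope.

Section Defs.
Variables (F : fieldType) (n : nat).
Local Notation M := 'M[F]_n.

Definition is_unital_subalgebra (A : M -> Prop) : Prop :=
  [/\ A 0, A 1%:M,
      (forall a b, A a -> A b -> A (a + b)),
      (forall (c : F) a, A a -> A (c *: a)) &
      (forall a b, A a -> A b -> A (a *m b))].

(* Product of a list of matrices (works for every n, including n = 0). *)
Definition prodmx (s : seq M) : M := foldr (@mulmx F n n n) 1%:M s.

Definition is_ideal_of (A I : M -> Prop) : Prop :=
  [/\ (forall x, I x -> A x), I 0,
      (forall x y, I x -> I y -> I (x + y)) /\
      (forall (c : F) x, I x -> I (c *: x)),
      (forall a x, A a -> I x -> I (a *m x)) &
      (forall a x, A a -> I x -> I (x *m a))].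

Definition nilpotent_set (I : M -> Prop) : Prop :=
  exists m : nat, forall s : seq M, size s = m -> (forall y, y \in s -> I y) -> prodmx s = 0.

(* Semisimple finite-dimensional algebra: no nonzero nilpotent two-sided
   ideal (i.e. zero Jacobson radical). *)
Definition semisimple_subalgebra (A : M -> Prop) : Prop :=
  is_unital_subalgebra A /\
  forall I, is_ideal_of A I -> nilpotent_set I -> forall x, I x -> x = 0.

Definition in_centralizer_units (A : M -> Prop) (g : M) : Prop :=
  g \in unitmx /\ forall a, A a -> g *m a = a *m g.

Inductive polyfun (k : nat) : (('I_k -> M) -> F) -> Prop :=
| pf_const (c : F) : polyfun (fun _ => c)
| pf_coord (l : 'I_k) (i j : 'I_n) : polyfun (fun x => x l i j)
| pf_add f g : polyfun f -> polyfun g -> polyfun (fun x => f x + g x)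
| pf_mul f g : polyfun f -> polyfun g -> polyfun (fun x => f x * g x)
| pf_ext f g : polyfun f -> (forall x, f x = g x) -> polyfun g.

Definition Aword (k : nat) (s : seq (M * 'I_k)) (x : 'I_k -> M) : M :=
  prodmx [seq p.1 *m x p.2 | p <- s].

Inductive pure_Atrace_poly (A : M -> Prop) (k : nat) : (('I_k -> M) -> F) -> Prop :=
| tp_const (c : F) : pure_Atrace_poly A (fun _ => c)
| tp_gen (s : seq (M * 'I_k)) :
    (forall p, p \in s -> A p.1) -> pure_Atrace_poly A (fun x => \tr (Aword s x))
| tp_add f g : pure_Atrace_poly A f -> pure_Atrace_poly A g ->
    pure_Atrace_poly A (fun x => f x + g x)
| tp_mul f g : pure_Atrace_poly A f -> pure_Atrace_poly A g ->
    pure_Atrace_poly A (fun x => f x * g x)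
| tp_ext f g : pure_Atrace_poly A f -> (forall x, f x = g x) -> pure_Atrace_poly A g.

End Defs.

(* Main.v *)
(** A semisimple algebra in characteristic zero is separable: its regular trace form is
nondegenerate (an element of the radical has powers of trace zero, hence is nilpotent, and a nil
ideal is nilpotent), and dual bases [e_j], [e^j] for it satisfy [sum_j e^j e_j = 1], while
[y |-> sum_j e^j y e_j] maps all matrices into the centralizer [B] of [A].

Polarizing the homogeneous components of [f] reduces the theorem to a multilinear function
[z |-> tr (T (z_1 (x) ... (x) z_d))]. Invariance under the units of [B], which are dense in [B], and
polarization show that [T] commutes with all symmetrized tensors of elements of [B]. Averaging over
the symmetric group and the dual bases then writes [T] as a combination of operators
[(a_1 (x) ... (x) a_d) s] with [a_i] in [A] and [s] a permutation, and the trace of such an operator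
times [z_1 (x) ... (x) z_d] is a product of traces, one for each cycle of [s]. *)
Require Import Defs.
From HB Require Import structures.
From mathcomp Require Import all_boot all_order all_algebra all_fingroup.
From Stdlib Require Import Classical_Prop.
Set Implicit Arguments. Unset Strict Implicit. Unset Printing Implicit Defensive.
Import Order.TTheory GRing.Theory Num.Theory.
Local Open Scope ring_scope.

(** * Separability of semisimple algebras *)

(** Free rows spanning part of [S] are extended by a vector of [S] outside their span as long as one
    exists, which is decided classically; [k] bounds the number of extensions still possible. *)
Lemma subspace_basis (F : fieldType) (m : nat) (S : 'rV[F]_m -> Prop) :
  S 0 -> (forall u v, S u -> S v -> S (u + v)) ->
  (forall (c : F) u, S u -> S (c *: u)) ->
  exists r (B : 'M[F]_(r, m)), row_free B /\ forall v, S v <-> (v <= B)%MS.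
Proof.
move=> S0 SD SZ.
suff H k r (B : 'M[F]_(r, m)) : (m <= k + r)%N -> row_free B ->
    (forall v, (v <= B)%MS -> S v) ->
    exists r' (B' : 'M[F]_(r', m)),
      row_free B' /\ forall v, S v <-> (v <= B')%MS.
  apply: (H m 0%N (0 : 'M_(0, m))); rewrite ?addn0 //; first by rewrite /row_free mxrank0.
  by move=> v /submx0null->.
elim: k r B => [|k IH] r B le_m freeB SB.
  exists r, B; split=> // v; split=> [_|]; last exact: SB.
  apply: submx_full; rewrite /row_full eqn_leq rank_leq_col.
  by rewrite (eqP freeB).
have [[v [Sv nBv]]|noS] := classic (exists v, S v /\ ~~ (v <= B)%MS); last first.
  exists r, B; split=> // v; split=> [Sv|]; last exact: SB.
  by apply/negP => /negP nBv; apply: noS; exists v.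
apply: (IH r.+1 (col_mx v B : 'M_(1 + r, m))).
- by rewrite addnS -addSn.
- rewrite /row_free; change (\rank (col_mx v B) == (1 + r)%N).
  have v0 : v != 0 by apply: contraNneq nBv => ->; rewrite sub0mx.
  rewrite -addsmxE mxrank_disjoint_sum ?(eqP freeB) ?rank_rV ?v0 //.
  apply/eqP; rewrite -submx0; apply/rV_subP => w.
  rewrite sub_capmx => /andP[/sub_rVP[c ->] cvB].
  have [->|c0] := eqVneq c 0; first by rewrite scale0r sub0mx.
  by case/negP: nBv; rewrite -(scalerK c0 v) scalemx_sub.
- move=> w; rewrite -(addsmxE v B) => /sub_addsmxP[[c d] /= ->].
  apply: SD; last by apply: SB; apply: submxMl.
  by rewrite (mx11_scalar c) mul_scalar_mx; apply: SZ.
Qed.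

Lemma pchar0_natf_eq0 (F : fieldType) : [pchar F] =i pred0 ->
  forall m : nat, (m%:R == 0 :> F) = (m == 0)%N.
Proof. by move=> ch; apply/pcharf0P. Qed.

Lemma pchar0_natr_inj (F : fieldType) : [pchar F] =i pred0 ->
  injective (fun m : nat => m%:R : F).
Proof.
move=> ch; have le i j : i%:R = j%:R :> F -> (i <= j)%N.
  case: leqP => // ji E; have /eqP : (i - j)%:R = 0 :> F.
    by rewrite natrB ?E ?subrr // ltnW.
  by rewrite (pchar0_natf_eq0 ch) subn_eq0 leqNgt ji.
by move=> i j E; apply/eqP; rewrite eqn_leq !le.
Qed.

(** The naturals embed in [F], which provides [size p] distinct roots. *)
Lemma pchar0_poly_eq0 (F : fieldType) (p : {poly F}) :
  [pchar F] =i pred0 -> (forall t, p.[t] = 0) -> p = 0.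
Proof.
move=> ch p0; apply: (@roots_geq_poly_eq0 _ _ [seq i%:R | i <- iota 0 (size p)]).
- by apply/allP => t _; rewrite /root p0.
- by rewrite map_inj_uniq ?iota_uniq //; apply: pchar0_natr_inj.
- by rewrite size_map size_iota.
Qed.

(** In the rank factorization [e = c *m b], cancelling the full-rank outer factors of
    [c b c b = c b] leaves [b *m c = 1], an identity matrix of size the rank. *)
Lemma idempotent_trace (F : fieldType) (n : nat) (e : 'M[F]_n) :
  e *m e = e -> \tr e = (\rank e)%:R.
Proof.
move=> ee; rewrite -{1}(mulmx_base e) mxtrace_mulC.
suff -> : row_base e *m col_base e = 1%:M by rewrite mxtrace1.
have := mulmx_base e; move: (col_base e) (row_base e) (col_base_full e)
  (row_base_free e) => c b c_full b_free cb.
apply: (row_free_inj b_free); apply: (@row_full_inj _ _ _ _ c) => //=.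
by rewrite mul1mx !mulmxA cb -mulmxA cb ee.
Qed.

(* With [char_poly b * 'X = q * 'X^a] and [q] prime to ['X], a Bezout relation gives a polynomial
   [u * 'X^a] in [b] that is idempotent; its trace, hence its rank, is zero. *)
Lemma nilpotent_of_trace (F : fieldType) (n : nat) (b : 'M[F]_n.+1) :
  [pchar F] =i pred0 -> (forall k, \tr (b ^+ k.+1) = 0) -> exists m, b ^+ m = 0.
Proof.
move=> ch trb.
(* The extra factor ['X] forces [0 < a] even when [b] is invertible, so that the idempotent is a
   polynomial in [b] without constant term and has trace zero. *)
have [a [q nq0 Dq]] := multiplicity_XsubC (char_poly b * 'X) 0.
have p0 : char_poly b * 'X != 0.
  by rewrite mulf_neq0 ?polyX_eq0 // monic_neq0 // char_poly_monic.
rewrite p0 /= subr0 in nq0 Dq.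
have a_gt0 : (0 < a)%N.
  case: a Dq => // Dq; move: nq0; rewrite -[q]mulr1 -(expr0 'X) -Dq.
  by rewrite /root hornerM hornerX mulr0 eqxx.
have cop : coprimep ('X^a) q.
  by rewrite coprimep_expl // coprimep_sym -['X]subr0 coprimep_XsubC.
have /Bezout_eq1_coprimepP[[u v] /= uv1] := cop.
have hq0 : horner_mx b (q * 'X^a) = 0.
  by rewrite -Dq rmorphM /= Cayley_Hamilton mul0r.
have hw w : horner_mx b (w * (q * 'X^a)) = 0 by rewrite rmorphM /= hq0 mulr0.
pose e := horner_mx b (u * 'X^a).
have hX : horner_mx b 'X = b by rewrite horner_mx_X.
have He : e = 1 - horner_mx b (v * q).
  by apply/eqP; rewrite eq_sym subr_eq -rmorphD /= uv1 rmorph1.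
have ee : e *m e = e.
  rewrite -[e *m e]/(e * e) {1}He mulrBl mul1r -[RHS]subr0; congr (_ - _).
  rewrite /e -rmorphM /=.
  have -> : v * q * (u * 'X^a) = v * u * (q * 'X^a) by rewrite mulrACA.
  exact: hw.
have tre : \tr e = 0.
  have -> : e = horner_mx b (u * 'X^(a.-1) * 'X).
    by rewrite /e -mulrA -exprSr prednK.
  rewrite rmorphM /= hX; set w := _ * 'X^_.
  rewrite -[w]coefK poly_def rmorph_sum mulr_suml raddf_sum big1 // => i _ /=.
  by rewrite linearZ /= rmorphXn /= hX -scalerAl linearZ /= -exprSr trb mulr0.
have e0 : e = 0.
  apply/eqP; rewrite -mxrank_eq0 -(pchar0_natf_eq0 ch) -idempotent_trace //.
  by rewrite tre.
(* Since [e = 0], the polynomial [v * q] takes the value 1 at [b]; hence [b ^+ a] is the value of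
   [v * (q * 'X^a)], which vanishes by Cayley-Hamilton. *)
exists a; rewrite -hX -rmorphXn /= -[RHS](mul0r (horner_mx b 'X^a)) -e0 He.
rewrite mulrBl mul1r -rmorphM /= -mulrA.
have -> : horner_mx b (v * (q * 'X^a)) = 0 by exact: hw.
by rewrite subr0.
Qed.

Lemma prodmx_cat (F : fieldType) (n : nat) (s t : seq 'M[F]_n) :
  prodmx (s ++ t) = prodmx s *m prodmx t.
Proof. by elim: s => [|a s IH] /=; rewrite ?mul1mx // IH mulmxA. Qed.

(** The pseudo-inverse of the basis extends the coordinates linearly to all matrices, so no type for
    the subspace is needed; [co] is meaningful only on [I]. *)
Lemma matrix_subspace_basis (F : fieldType) (n : nat) (I : 'M[F]_n -> Prop) :
  I 0 -> (forall a b, I a -> I b -> I (a + b)) ->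
  (forall (c : F) a, I a -> I (c *: a)) ->
  exists r (e : 'I_r -> 'M[F]_n) (co : {linear 'M[F]_n -> 'rV[F]_r}),
    [/\ forall j, I (e j),
        forall a, I a -> a = \sum_j co a 0 j *: e j
      & forall c : 'rV[F]_r, co (\sum_j c 0 j *: e j) = c].
Proof.
move=> I0 ID IZ; have [||| r [B [freeB SB]]] := @subspace_basis F _ (fun v => I (vec_mx v)).
- by rewrite linear0.
- by move=> u v Iu Iv; rewrite linearD; apply: ID.
- by move=> c u Iu; rewrite linearZ; apply: IZ.
have Esum (c : 'rV[F]_r) :
    \sum_j c 0 j *: vec_mx (row j B) = vec_mx (c *m B) :> 'M[F]_n.
  rewrite mulmx_sum_row linear_sum; apply: eq_bigr => j _.
  by rewrite linearZ.
exists r, (fun j => vec_mx (row j B)), (mulmxr (pinvmx B) \o mxvec).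
split=> [j|a Ia|c] /=.
- by apply/SB; rewrite row_sub.
- have aB : (mxvec a <= B)%MS by apply/SB; rewrite mxvecK.
  by rewrite Esum mulmxKpV // mxvecK.
- by rewrite Esum vec_mxK mulmxKp.
Qed.

(** * Nil matrix algebras are nilpotent *)

Section NilNilpotent.
Variables (F : fieldType) (n : nat) (I : 'M[F]_n -> Prop).
Hypotheses (I0 : I 0) (ID : forall a b, I a -> I b -> I (a + b))
  (IZ : forall (c : F) a, I a -> I (c *: a))
  (IM : forall a b, I a -> I b -> I (a *m b))
  (I_nil : forall a, I a -> exists m, prodmx (nseq m a) = 0).

Lemma nil_fixed_eq0 (y : 'rV_n) a : I a -> y = y *m a -> y = 0.
Proof.
move=> /I_nil[m am] ya; rewrite -(mulmx0 _ y) -am.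
by elim: m {am} => [|m IH] /=; rewrite ?mulmx1 // mulmxA -ya.
Qed.

(* Induction on the dimension of [x I]: for [y] in [x I], the inclusion of [y I] in [x I] is strict
   unless [y = 0], since otherwise [y] lies in [y I] and is fixed by a nilpotent element. *)
Lemma nil_nilpotent_at (x : 'rV[F]_n) :
  exists m, forall s : seq 'M[F]_n, (m <= size s)%N ->
    (forall a, a \in s -> I a) -> x *m prodmx s = 0.
Proof.
have [r [e [co [Ie coE _]]]] := matrix_subspace_basis I0 ID IZ.
have spane a : I a -> exists c : 'rV_r, a = \sum_j c 0 j *: e j.
  by move=> /coE Da; exists (co a).
pose xI x := \matrix_(i < r) (x *m e i) : 'M[F]_(r, n).
have xIP y z : (y <= xI z)%MS -> exists2 a, I a & y = z *m a.
  move=> /submxP[c ->]; exists (\sum_j c 0 j *: e j).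
    by apply: big_ind => // j _; apply: IZ.
  rewrite mulmx_sum_row mulmx_sumr; apply: eq_bigr => j _.
  by rewrite rowK scalemxAr.
have sub_xI z a : I a -> (z *m a <= xI z)%MS.
  move=> /spane[c ->]; apply/submxP; exists c.
  rewrite mulmx_sumr mulmx_sum_row; apply: eq_bigr => j _.
  by rewrite rowK scalemxAr.
have [k] := ubnP (\rank (xI x)); elim: k x => // k IH x; rewrite ltnS => rk.
have /fin_all_exists[m Pm] (j : 'I_r) : exists m, forall s : seq 'M[F]_n,
    (m <= size s)%N -> (forall a, a \in s -> I a) -> x *m e j *m prodmx s = 0.
  set y := x *m e j.
  have [->|y0] := eqVneq y 0; first by exists 0%N => *; rewrite mul0mx.
  apply: IH; apply: leq_trans rk; rewrite ltn_neqAle.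
  have sub : (xI y <= xI x)%MS.
    apply/row_subP => i; rewrite rowK /y -mulmxA.
    exact/sub_xI/IM.
  rewrite mxrankS // andbT; apply: contraNneq y0.
  move=> /eqP; case: (mxrank_leqif_eq sub) => _ -> /eqmxP eqI.
  have /xIP[a Ia ya] : (y <= xI y)%MS by rewrite eqI sub_xI.
  exact/eqP/(nil_fixed_eq0 Ia ya).
(* The successor accounts for the first factor, which is expanded in the basis [e]; the remaining
   factors annihilate every [x *m e j]. *)
exists (\max_j m j).+1 => -[|a s] //=; rewrite ltnS => lt_m Is.
have /spane[c ->] : I a by apply: Is; rewrite mem_head.
rewrite mulmxA mulmx_sumr mulmx_suml big1 // => j _.
rewrite -scalemxAr -scalemxAl Pm ?scaler0 //.
  by apply: leq_trans lt_m; rewrite leq_bigmax.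
by move=> b bs; apply: Is; rewrite in_cons bs orbT.
Qed.

Lemma nil_nilpotent : nilpotent_set I.
Proof.
have /fin_all_exists[m Pm] (i : 'I_n) := nil_nilpotent_at (delta_mx 0 i).
exists (\max_i m i) => s sz Is; apply/row_matrixP => i.
by rewrite row0 rowE Pm // sz (leq_bigmax i).
Qed.
End NilNilpotent.

Lemma prodmx_nilpotent_of_trace (F : fieldType) (n : nat) (b : 'M[F]_n) :
  [pchar F] =i pred0 -> (forall k, \tr (prodmx (nseq k.+1 b)) = 0) ->
  exists m, prodmx (nseq m b) = 0.
Proof.
case: n b => [|n] b ch trb; first by exists 0%N; rewrite [LHS]thinmx0.
have bX k : prodmx (nseq k b) = b ^+ k by elim: k => //= k ->; rewrite exprS.
have [k|m bm] := nilpotent_of_trace (b := b) ch; first by rewrite -bX trb.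
by exists m; rewrite bX.
Qed.

(** * The regular trace form and its dual bases *)

Section Separability.
Variables (F : fieldType) (n : nat) (A : 'M[F]_n -> Prop).
Hypotheses (ch : [pchar F] =i pred0) (ssA : semisimple_subalgebra A).

Let A0 : A 0. Proof. by case: ssA => -[]. Qed.
Let A1 : A 1%:M. Proof. by case: ssA => -[]. Qed.
Let AD a b : A a -> A b -> A (a + b). Proof. by case: ssA => -[_ _ + _ _ _]; apply. Qed.
Let AZ (c : F) a : A a -> A (c *: a). Proof. by case: ssA => -[_ _ _ + _ _]; apply. Qed.
Let AM a b : A a -> A b -> A (a *m b). Proof. by case: ssA => -[_ _ _ _ + _]; apply. Qed.

Variables (r : nat) (e : 'I_r -> 'M[F]_n) (co : {linear 'M[F]_n -> 'rV[F]_r}).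
Hypotheses (Ae : forall j, A (e j))
  (coE : forall a, A a -> a = \sum_j co a 0 j *: e j)
  (coK : forall c : 'rV[F]_r, co (\sum_j c 0 j *: e j) = c).

(** Elements of [A] are row vectors of coordinates, so right multiplication is the action that makes
    [reg_mx] multiplicative on [A]. *)
Definition reg_mx (a : 'M[F]_n) : 'M[F]_r := \matrix_j co (e j *m a).
Definition reg_trace (a : 'M[F]_n) : F := \tr (reg_mx a).

Fact reg_trace_linear : scalar reg_trace.
Proof.
move=> c a b; rewrite /reg_trace -linearZ -linearD /=; congr (\tr _).
by apply/matrixP => i j; rewrite !mxE mulmxDr -scalemxAr linearP !mxE.
Qed.
HB.instance Definition _ :=
  GRing.isLinear.Build F 'M[F]_n F *%R reg_trace reg_trace_linear.

Lemma co_mul x a : A x -> co (x *m a) = co x *m reg_mx a.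
Proof.
move=> /coE Dx; rewrite {1}Dx mulmx_suml linear_sum mulmx_sum_row.
by apply: eq_bigr => j _; rewrite -scalemxAl linearZ rowK.
Qed.

Lemma reg_mxM a b : A a -> reg_mx (a *m b) = reg_mx a *m reg_mx b.
Proof.
move=> Aa; apply/row_matrixP => j.
by rewrite row_mul !rowK mulmxA co_mul //; apply: AM.
Qed.

Lemma reg_traceC a b : A a -> A b -> reg_trace (a *m b) = reg_trace (b *m a).
Proof. by move=> Aa Ab; rewrite /reg_trace !reg_mxM // mxtrace_mulC. Qed.

Lemma reg_trace_nondegenerate a :
  A a -> (forall b, A b -> reg_trace (a *m b) = 0) -> a = 0.
Proof.
pose J x := A x /\ forall b, A b -> reg_trace (x *m b) = 0.
have J0 : J 0 by split=> // b _; rewrite mul0mx linear0.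
have JD x y : J x -> J y -> J (x + y).
  move=> [Ax x0] [Ay y0]; split=> [|b Ab]; first exact: AD.
  by rewrite mulmxDl linearD /= x0 ?y0 ?addr0.
have JZ c x : J x -> J (c *: x).
  move=> [Ax x0]; split=> [|b Ab]; first exact: AZ.
  by rewrite -scalemxAl linearZ /= x0 ?mulr0.
have Jl y x : A y -> J x -> J (y *m x).
  move=> Ay [Ax x0]; split=> [|b Ab]; first exact: AM.
  by rewrite -mulmxA reg_traceC ?x0 // -?mulmxA ?x0 //; apply: AM.
have Jr y x : A y -> J x -> J (x *m y).
  move=> Ay [Ax x0]; split=> [|b Ab]; first exact: AM.
  by rewrite -mulmxA x0 //; apply: AM.
have APow k x : A x -> A (prodmx (nseq k x)).
  by move=> Ax; elim: k => //= k IH; apply: AM.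
have J_nil x : J x -> exists m, prodmx (nseq m x) = 0.
  move=> [Ax x0].
  have regX k : reg_mx (prodmx (nseq k x)) = prodmx (nseq k (reg_mx x)).
    elim: k => [|k IH] /=; last by rewrite reg_mxM // IH.
    apply/row_matrixP => j; rewrite rowK mulmx1 row1.
    rewrite -[RHS]coK; congr (co _); rewrite (bigD1 j) //= mxE !eqxx scale1r.
    rewrite big1 ?addr0 // => i /negbTE ij.
    by rewrite mxE eqxx ij scale0r.
  have [k|m xm] := prodmx_nilpotent_of_trace (b := reg_mx x) ch.
    by rewrite -regX /= -[\tr _]/(reg_trace _) x0 //; apply: APow.
  (* The regular representation is faithful: the coordinates of [x^m] are those of 1 times the zero
     matrix. *)
  exists m; rewrite [LHS]coE; last exact: APow.
  rewrite big1 // => j _.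
  by rewrite -[prodmx _]mul1mx co_mul // regX xm mulmx0 mxE scale0r.
move=> Aa a0; case: ssA => _ ss; apply: (ss J) => //.
  by split=> // x [].
by apply: (nil_nilpotent J0 JD JZ _ J_nil) => x y [Ax _] Jy; apply: Jl.
Qed.

Definition gram_mx : 'M[F]_r := \matrix_(i, j) reg_trace (e i *m e j).

Lemma gram_mx_unit : gram_mx \in unitmx.
Proof.
rewrite -row_free_unit; apply: inj_row_free => u uG.
rewrite -[u]coK.
suff -> : \sum_j u 0 j *: e j = 0 by rewrite linear0.
apply: reg_trace_nondegenerate.
  by apply: big_ind => // j _; apply: AZ.
move=> b /coE ->; rewrite mulmx_sumr linear_sum big1 //= => j _.
rewrite -scalemxAr linearZ /= mulmx_suml linear_sum /=.
have /matrixP/(_ 0 j) := uG; rewrite !mxE => uGj.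
rewrite -[X in _ * X]/(_) (eq_bigr (fun i => u 0 i * gram_mx i j)) ?uGj ?mulr0 //.
by move=> i _; rewrite -scalemxAl linearZ mxE.
Qed.

Definition dual_basis (j : 'I_r) : 'M[F]_n := \sum_k invmx gram_mx k j *: e k.

Lemma dual_basis_in j : A (dual_basis j).
Proof. by apply: big_ind => // k _; apply: AZ. Qed.

Lemma reg_trace_dual i j : reg_trace (e i *m dual_basis j) = (i == j)%:R.
Proof.
have /matrixP/(_ i j) := mulmxV gram_mx_unit; rewrite !mxE => <-.
rewrite mulmx_sumr linear_sum; apply: eq_bigr => k _ /=.
by rewrite -scalemxAr linearZ /= mulrC mxE.
Qed.

Lemma co_dual x j : A x -> reg_trace (x *m dual_basis j) = co x 0 j.
Proof.
move=> /coE Dx; rewrite {1}Dx mulmx_suml linear_sum (bigD1 j) //=.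
rewrite -scalemxAl linearZ /= reg_trace_dual eqxx mulr1 big1 ?addr0 // => i ij.
by rewrite -scalemxAl linearZ /= reg_trace_dual (negbTE ij) mulr0.
Qed.

Lemma dual_basis_expand x : A x ->
  x = \sum_j reg_trace (e j *m x) *: dual_basis j.
Proof.
move=> /coE Dx; rewrite {1}Dx.
have De i : e i = \sum_j gram_mx j i *: dual_basis j.
  under eq_bigr do rewrite scaler_sumr; rewrite exchange_big /=.
  rewrite (bigD1 i) //= [X in _ + X]big1 => [|k ki].
    have /matrixP/(_ i i) := mulVmx gram_mx_unit; rewrite !mxE eqxx => H.
    under eq_bigr do rewrite scalerA mulrC.
    by rewrite -scaler_suml H scale1r addr0.
  have /matrixP/(_ k i) := mulVmx gram_mx_unit; rewrite !mxE (negbTE ki) => H.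
  under eq_bigr do rewrite scalerA mulrC.
  by rewrite -scaler_suml H scale0r.
under eq_bigr do rewrite De scaler_sumr.
rewrite exchange_big; apply: eq_bigr => j _ /=.
rewrite [in RHS]Dx mulmx_sumr [reg_trace _]linear_sum scaler_suml; apply: eq_bigr => i _ /=.
by rewrite scalerA -scalemxAr [reg_trace _]linearZ mxE.
Qed.

(** The scalars [reg_trace (e k *m a *m dual_basis j)] are at once the coordinates of
    [a *m dual_basis j] in the dual basis and those of [e k *m a] in the basis [e]. *)
Lemma dual_basis_casimir y a : A a ->
  a *m (\sum_j dual_basis j *m y *m e j) = (\sum_j dual_basis j *m y *m e j) *m a.
Proof.
move=> Aa; rewrite mulmx_sumr mulmx_suml.
transitivity (\sum_j \sum_k reg_trace (e k *m a *m dual_basis j) *: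
    (dual_basis k *m y *m e j)).
  apply: eq_bigr => j _; rewrite !mulmxA.
  rewrite [a *m _]dual_basis_expand; last exact/AM/dual_basis_in.
  rewrite !mulmx_suml; apply: eq_bigr => k _.
  by rewrite -!scalemxAl mulmxA.
rewrite exchange_big; apply: eq_bigr => k _ /=.
rewrite -!mulmxA [X in _ = _ *m (_ *m X)]coE; last exact: AM.
rewrite !mulmx_sumr; apply: eq_bigr => j _.
by rewrite -!scalemxAr !mulmxA co_dual //; apply: AM.
Qed.

(* The regular trace of [a] equals the regular trace of [a *m c] with [c] the sum below. *)
Lemma dual_basis_sum : \sum_j dual_basis j *m e j = 1%:M.
Proof.
have Ac : A (\sum_j dual_basis j *m e j).
  by apply: big_ind => // j _; apply: AM => //; apply: dual_basis_in.
apply/eqP; rewrite -subr_eq0; apply/eqP; apply: reg_trace_nondegenerate.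
  by rewrite -scaleN1r; apply: AD => //; apply: AZ.
move=> a Aa; rewrite mulmxBl mul1mx linearB /=; apply/eqP.
rewrite subr_eq0; apply/eqP.
rewrite reg_traceC // mulmx_sumr linear_sum /=.
apply: eq_bigr => j _; rewrite mulmxA reg_traceC //; last first.
  exact/AM/dual_basis_in.
by rewrite mulmxA co_dual ?mxE //; apply: AM.
Qed.

End Separability.

(** The families form a separability idempotent: [y |-> \sum_j u j *m y *m v j] is a projection of
    all matrices onto the centralizer of [A]. *)
Lemma semisimple_separable (F : fieldType) (n : nat) (A : 'M[F]_n -> Prop) :
  [pchar F] =i pred0 -> semisimple_subalgebra A ->
  exists r (u v : 'I_r -> 'M[F]_n),
    [/\ forall j, A (u j), forall j, A (v j), \sum_j u j *m v j = 1%:M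
      & forall y a, A a ->
          a *m (\sum_j u j *m y *m v j) = (\sum_j u j *m y *m v j) *m a].
Proof.
move=> ch ssA; have [[A0 A1 AD AZ AM] _] := ssA.
have [r [e [co [Ae coE coK]]]] := matrix_subspace_basis A0 AD AZ.
exists r, (dual_basis e co), e; split=> //.
- by move=> j; apply: dual_basis_in.
- exact: (dual_basis_sum ch ssA Ae coE coK).
- exact: (dual_basis_casimir ch ssA Ae coE coK).
Qed.

(** * Operators on tensor powers *)

(* Every linear map on matrices is a sum of maps [y |-> p *m y *m q]; applied to a projection onto
   the span of the [v j], this lets [T] move past the averages of [p] over [(u, v)]. *)
Lemma double_commutant_span (F : fieldType) (N : nat) (J : finType)
    (u v : J -> 'M[F]_N) (T : 'M[F]_N) :
  \sum_j u j *m v j = 1%:M ->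
  (forall y, T *m (\sum_j u j *m y *m v j) = (\sum_j u j *m y *m v j) *m T) ->
  exists k : J -> J -> F, T = \sum_i \sum_j k i j *: (u i *m v j).
Proof.
move=> uv1 comT.
pose V : 'M[F]_(#|J|, N * N) := \matrix_i mxvec (v (enum_val i)).
have vV j : (mxvec (v j) <= V)%MS.
  by rewrite -[j]enum_rankK -(rowK (fun i => mxvec (v (enum_val i)))) row_sub.
pose k y j : F := (mxvec y *m pinvmx V) 0 (enum_rank j).
have [pi [pi_k pi_v]] : exists pi : {linear 'M[F]_N -> 'M[F]_N},
    (forall y, pi y = \sum_j k y j *: v j) /\ (forall j, pi (v j) = v j).
  exists (vec_mx \o mulmxr (pinvmx V *m V) \o mxvec); split=> [y|j] /=; last first.
    by rewrite mulmxA mulmxKpV ?vV // mxvecK.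
  rewrite mulmxA mulmx_sum_row linear_sum /=.
  rewrite [RHS](reindex (@enum_val _ J)) /=; last exact: onW_bij (enum_val_bij _).
  by apply: eq_bigr => i _; rewrite linearZ /= /k enum_valK rowK mxvecK.
have piE y : pi y = \sum_a \sum_b \sum_c \sum_d
    pi (delta_mx a b) c d *: (delta_mx c a *m y *m delta_mx b d).
  rewrite {1}(matrix_sum_delta y) linear_sum.
  apply: eq_bigr => a _; rewrite linear_sum; apply: eq_bigr => b _ /=.
  rewrite linearZ /= [X in _ *: X]matrix_sum_delta scaler_sumr.
  apply: eq_bigr => c _; rewrite scaler_sumr; apply: eq_bigr => d _.
  rewrite scalerA mulrC -scalerA; congr (_ *: _).
  apply/matrixP => c' d'; rewrite !mxE (bigD1 b) //= big1 => [|b' bb']; last first.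
    by rewrite !mxE (negbTE bb') mulr0.
  rewrite !mxE (bigD1 a) //= big1 => [|a' aa']; last first.
    by rewrite !mxE (negbTE aa') andbF mul0r.
  by rewrite !mxE !eqxx !addr0 andbT /=; case: eqP; case: eqP; rewrite ?mulr1 ?mul1r ?mulr0 ?mul0r.
exists (fun i j => k (v i *m T) j).
have -> : \sum_i \sum_j k (v i *m T) j *: (u i *m v j) = \sum_i u i *m pi (v i *m T).
  apply: eq_bigr => i _; rewrite pi_k mulmx_sumr; apply: eq_bigr => j _.
  by rewrite scalemxAr.
(* In [T = \sum_j T *m u j *m pi (v j)], expanding [pi] into maps [y |-> p *m y *m q] produces [T]
   times an average of [p]; commuting the two and folding [pi] back gives
   [\sum_j u j *m pi (v j *m T)]. *)
rewrite -[LHS]mulmx1 -uv1.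
transitivity (\sum_a \sum_b \sum_c \sum_d pi (delta_mx a b) c d *:
   ((T *m \sum_j u j *m delta_mx c a *m v j) *m delta_mx b d)).
  rewrite mulmx_sumr; under eq_bigr do rewrite -pi_v piE !mulmx_sumr.
  rewrite exchange_big; apply: eq_bigr => a _ /=.
  under eq_bigr do rewrite !mulmx_sumr.
  rewrite exchange_big; apply: eq_bigr => b _ /=.
  under eq_bigr do rewrite !mulmx_sumr.
  rewrite exchange_big; apply: eq_bigr => c _ /=.
  under eq_bigr do rewrite !mulmx_sumr.
  rewrite exchange_big; apply: eq_bigr => d _ /=.
  rewrite mulmx_sumr mulmx_suml scaler_sumr; apply: eq_bigr => j _.
  by rewrite -!scalemxAr !mulmxA.
under [RHS]eq_bigr do rewrite piE !mulmx_sumr.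
rewrite [RHS]exchange_big; apply: eq_bigr => a _ /=.
under [RHS]eq_bigr do rewrite !mulmx_sumr.
rewrite [RHS]exchange_big; apply: eq_bigr => b _ /=.
under [RHS]eq_bigr do rewrite !mulmx_sumr.
rewrite [RHS]exchange_big; apply: eq_bigr => c _ /=.
under [RHS]eq_bigr do rewrite !mulmx_sumr.
rewrite [RHS]exchange_big; apply: eq_bigr => d _ /=.
rewrite comT !mulmx_suml scaler_sumr; apply: eq_bigr => j _.
by rewrite -!scalemxAr !mulmxA.
Qed.

(** This is the expansion of a product of factors [1 + G i] equal to 1 on [A] and to [1 - 1]
    outside, where [S] collects the indices at which the term 1 is chosen. *)
Lemma sum_sign_supersets (R : comNzRingType) (T : finType) (A : {set T}) :
  \sum_(S : {set T} | A \subset S) (-1) ^+ #|~: S| = (A == setT)%:R :> R.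
Proof.
pose G i : R := if i \in A then 0 else -1.
transitivity (\prod_(i : T) (1 + G i)).
  rewrite bigA_distr big_mkcond; apply: eq_bigr => S _ /=.
  have [AS|/subsetPn[x xA xS]] := boolP (A \subset S); last first.
    by rewrite (bigD1 x) //= (negbTE xS) /G xA mul0r.
  rewrite (bigID (mem S)) /= big1 ?mul1r => [|i ->] //.
  rewrite (eq_bigr (fun=> -1)) => [|i iS]; last first.
    by rewrite (negbTE iS) /G; case: ifP => // /(subsetP AS); rewrite (negbTE iS).
  by rewrite prodr_const; congr (_ ^+ _); apply: eq_card => i; rewrite !inE.
have [AT|] := eqVneq A setT.
  by rewrite big1 // => i _; rewrite /G AT inE addr0.
rewrite eqEsubset subsetT /= => /subsetPn[x _ xA].
by rewrite (bigD1 x) //= /G (negbTE xA) subrr mul0r.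
Qed.

(* Ryser's formula for the permanent, used as the polarization identity. *)
Lemma permanent_ryser (R : comNzRingType) d (m : 'I_d -> 'I_d -> R) :
  \sum_(s : 'S_d) \prod_i m i (s i) =
  \sum_(S : {set 'I_d}) (-1) ^+ #|~: S| * \prod_i \sum_(j in S) m i j.
Proof.
(* Permutations are the maps with full image, and that condition is then replaced by the signed sum
   over the sets [S] containing the image. *)
transitivity (\sum_(f : {ffun 'I_d -> 'I_d})
    (f @: setT == setT)%:R * \prod_i m i (f i)).
  have inj_im (f : {ffun 'I_d -> 'I_d}) : (f @: setT == setT) = injectiveb f.
    apply/idP/injectiveP => [/eqP fT|f_inj].
      have /imset_injP f_inj : #|f @: setT| == #|[set: 'I_d]| by rewrite fT //.
      by move=> x y; apply: f_inj; rewrite inE.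
    by rewrite eqEcard subsetT (card_imset _ f_inj) leqnn.
  rewrite [RHS](bigID (fun f : {ffun 'I_d -> 'I_d} => injectiveb f)) /=.
  rewrite [X in _ = _ + X]big1 => [|f /negbTE nf]; last by rewrite inj_im nf mul0r.
  rewrite addr0 (reindex (@pval _)) /=; last first.
    pose in_Sn := insubd (1%g : 'S_d).
    by exists in_Sn => /= f Uf; first apply: val_inj; apply: insubdK.
  by apply: eq_big => [s|s _]; rewrite ?(valP s) // inj_im (valP s) mul1r pvalE.
symmetry; under eq_bigr => S _ do rewrite bigA_distr_big mulr_sumr big_mkcond /=.
rewrite exchange_big; apply: eq_bigr => f _ /=.
rewrite -sum_sign_supersets mulr_suml [RHS]big_mkcond; apply: eq_bigr => S _ /=.
congr (if _ then _ else _).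
apply/ffun_onP/subsetP => [fS x /imsetP[i _ ->]|fS i]; first exact: fS.
by apply/fS/imset_f; rewrite inE.
Qed.

Section PermTensor.
Variables (F : fieldType) (n d : nat).
Local Notation M := 'M[F]_n.
Local Notation P := {ffun 'I_d -> 'I_n}.
Local Notation ev a := (enum_val a : P).

(* The operator of the tensor product [X 0 (x) ... (x) X (d-1)] followed by the permutation [s] of
   the factors, in the basis of the [d]-th tensor power indexed by [{ffun 'I_d -> 'I_n}]. *)
Definition perm_tensor (s : 'S_d) (X : 'I_d -> M) : 'M[F]_#|P| :=
  \matrix_(a, b) \prod_i X i (ev a i) (ev b (s i)).

Lemma eq_perm_tensor s X Y : (forall i, X i = Y i) -> perm_tensor s X = perm_tensor s Y.
Proof.
by move=> XY; apply/matrixP => a b; rewrite !mxE; apply: eq_bigr => i _; rewrite XY.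
Qed.

Lemma perm_tensorM s t X Y :
  perm_tensor s X *m perm_tensor t Y = perm_tensor (s * t) (fun i => X i *m Y (s i)).
Proof.
apply/matrixP => a b; rewrite !mxE.
under [RHS]eq_bigr do rewrite mxE.
rewrite bigA_distr_bigA /=.
(* The [i]-th factor of [X] meets the [s i]-th factor of [Y], so its summation index is entry [s i]
   of the intermediate index [c]. *)
pose h (c : 'I_#|P|) : P := [ffun i => ev c (s i)].
rewrite [RHS](reindex h) /=; last first.
  exists (fun f : P => enum_rank [ffun i => f ((s^-1)%g i)]) => [c _|f _].
    apply: enum_val_inj; rewrite enum_rankK; apply/ffunP => i.
    by rewrite !ffunE permKV.
  by apply/ffunP => i; rewrite ffunE enum_rankK ffunE permK.
apply: eq_bigr => c _; rewrite !mxE big_split /=; congr (_ * _).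
  by apply: eq_bigr => i _; rewrite ffunE.
rewrite (reindex_inj (@perm_inj _ s)) /=.
by apply: eq_bigr => i _; rewrite ffunE permM.
Qed.

Lemma perm_tensor1 : perm_tensor 1 (fun=> 1%:M) = 1%:M.
Proof.
apply/matrixP => a b; rewrite !mxE.
have [->|ab] := eqVneq a b; first by rewrite big1 // => i _; rewrite mxE perm1 eqxx.
have [i ne|eq_ab] := pickP (fun i => ev a i != ev b i).
  by rewrite (bigD1 i) //= mxE perm1 (negbTE ne) mul0r.
case/eqP: ab; apply: enum_val_inj; apply/ffunP => i.
by apply/eqP/negP => /negP; rewrite eq_ab.
Qed.

Lemma perm_tensor_sum s (J : finType) (X : 'I_d -> J -> M) :
  perm_tensor s (fun i => \sum_j X i j) =
  \sum_(f : {ffun 'I_d -> J}) perm_tensor s (fun i => X i (f i)).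
Proof.
apply/matrixP => a b; rewrite summxE !mxE.
under eq_bigr do rewrite summxE.
by rewrite bigA_distr_bigA; apply: eq_bigr => f _; rewrite mxE.
Qed.

Lemma delta_perm_tensor a b :
  delta_mx a b = perm_tensor 1 (fun i => delta_mx (ev a i) (ev b i)).
Proof.
apply/matrixP => a' b'; rewrite !mxE.
have [/andP[/eqP-> /eqP->]|ab] := boolP ((a' == a) && (b' == b)).
  by rewrite big1 // => i _; rewrite mxE perm1 !eqxx.
have [i ne|eq_ab] := pickP (fun i =>
    ~~ ((ev a' i == ev a i) && (ev b' i == ev b i))).
  by rewrite (bigD1 i) //= mxE perm1 (negbTE ne) mul0r.
case/negP: ab; apply/andP; split; apply/eqP/enum_val_inj/ffunP => i.
  by move/negbFE/andP: (eq_ab i) => [/eqP].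
by move/negbFE/andP: (eq_ab i) => [_ /eqP].
Qed.

Lemma tr_mul_delta N (T : 'M[F]_N) a b : \tr (T *m delta_mx a b) = T b a.
Proof.
rewrite /mxtrace (bigD1 b) //= big1 => [|i ib].
  rewrite !mxE (bigD1 a) //= big1 => [|j ja]; first by rewrite !mxE !eqxx mulr1 !addr0.
  by rewrite mxE (negbTE ja) mulr0.
by rewrite mxE big1 // => j _; rewrite mxE (negbTE ib) andbF mulr0.
Qed.

(** The matrix units of the tensor power are elementary tensors, and pairing with them reads off
    every entry. *)
Lemma eq_of_perm_tensor_trace (T U : 'M[F]_#|P|) :
  (forall z, \tr (T *m perm_tensor 1 z) = \tr (U *m perm_tensor 1 z)) -> T = U.
Proof.
by move=> TU; apply/matrixP => a b; rewrite -!tr_mul_delta delta_perm_tensor TU.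
Qed.

(** Ryser's formula applied entrywise; it reduces commutation with symmetrized tensors to
    commutation with tensor powers of a single matrix. *)
Lemma perm_tensor_polarization (b : 'I_d -> M) :
  \sum_(s : 'S_d) perm_tensor 1 (fun i => b (s i)) =
  \sum_(S : {set 'I_d}) (-1) ^+ #|~: S| *: perm_tensor 1 (fun=> \sum_(j in S) b j).
Proof.
apply/matrixP => p q; rewrite !summxE.
under eq_bigr do rewrite mxE.
under [RHS]eq_bigr do rewrite !mxE.
under [RHS]eq_bigr do under eq_bigr do rewrite summxE.
exact: (permanent_ryser (fun i j => b j _ _)).
Qed.

Variable A : M -> Prop.
Hypothesis ch : [pchar F] =i pred0.

(** The matrix [b + t] commutes with [A] and is a unit unless [t] is a root of [char_poly (- b)].
    Each entry [D] of the commutator is a polynomial in [t], so [D * char_poly (- b)] vanishes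
    everywhere; thus [D = 0], and [t = 0] gives the claim. *)
Lemma commute_units_commute (T : 'M[F]_#|P|) :
  (forall g, in_centralizer_units A g ->
     T *m perm_tensor 1 (fun=> g) = perm_tensor 1 (fun=> g) *m T) ->
  forall b, (forall a, A a -> b *m a = a *m b) ->
     T *m perm_tensor 1 (fun=> b) = perm_tensor 1 (fun=> b) *m T.
Proof.
move=> comT b bA.
pose bX p q : {poly F} := (b p q)%:P + (p == q)%:R%:P * 'X.
pose K (a c : 'I_#|P|) : {poly F} := \prod_(i < d) bX (ev a i) (ev c i).
have KE t a c : perm_tensor 1 (fun=> b + t%:M) a c = (K a c).[t].
  rewrite mxE horner_prod; apply: eq_bigr => i _.
  by rewrite perm1 !hornerE !mxE mulr_natl.
apply/matrixP => a c.
pose D : {poly F} := \sum_j ((T a j)%:P * K j c - K a j * (T j c)%:P).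
have DE t : D.[t] = (T *m perm_tensor 1 (fun=> b + t%:M) -
                     perm_tensor 1 (fun=> b + t%:M) *m T) a c.
  rewrite horner_sum !mxE -sumrB; apply: eq_bigr => j _.
  by rewrite !hornerE !KE.
suff D0 : D = 0.
  apply/eqP; rewrite -subr_eq0; move: (DE 0); rewrite D0 horner0.
  have -> : perm_tensor 1 (fun=> b + 0%:M) = perm_tensor 1 (fun=> b).
    by apply: eq_perm_tensor => i; rewrite raddf0 addr0.
  by rewrite !mxE => <-.
have cp0 : char_poly (- b) != 0 by rewrite monic_neq0 // char_poly_monic.
have /eqP : D * char_poly (- b) = 0.
  apply: (pchar0_poly_eq0 ch) => t; rewrite hornerM.
  have [->|nt] := eqVneq (char_poly (- b)).[t] 0; first by rewrite mulr0.
  suff -> : D.[t] = 0 by rewrite mul0r.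
  rewrite DE comT ?subrr ?mxE //; split=> [|x Ax].
    rewrite unitmxE unitfE; apply: contra_neq nt => dt0.
    rewrite /char_poly -horner_evalE -det_map_mx -[RHS]dt0.
    congr (\det _); apply/matrixP => i j.
    rewrite !mxE /= horner_evalE !hornerE /= opprK addrC; congr (_ + _).
    by case: eqP => _; rewrite ?mulr1n ?mulr0n ?hornerE.
  by rewrite mulmxDl mulmxDr bA // scalar_mxC.
by rewrite mulf_eq0 (negbTE cp0) orbF => /eqP.
Qed.

End PermTensor.

Lemma commute_tensor_span (F : fieldType) (n d : nat) (A : 'M[F]_n -> Prop)
    (T : 'M[F]_#|{ffun 'I_d -> 'I_n}|) :
  [pchar F] =i pred0 -> semisimple_subalgebra A ->
  (forall b, (forall a, A a -> b *m a = a *m b) ->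
     T *m perm_tensor 1 (fun=> b) = perm_tensor 1 (fun=> b) *m T) ->
  exists (K : finType) (c : K -> F) (s : K -> 'S_d) (X : K -> 'I_d -> 'M[F]_n),
    (forall k i, A (X k i)) /\ T = \sum_k c k *: perm_tensor (s k) (X k).
Proof.
move=> ch ssA comT; have [[A0 A1 AD AZ AM] _] := ssA.
have [r [u [v [Au Av uv1 uvC]]]] := semisimple_separable ch ssA.
pose avg y := \sum_j u j *m y *m v j.
pose J : finType := ('S_d * {ffun 'I_d -> 'I_r})%type.
pose U (j : J) := d`!%:R^-1 *: perm_tensor j.1 (fun i => u (j.2 i)).
pose V (j : J) := perm_tensor (j.1^-1)%g (fun i => v (j.2 ((j.1^-1)%g i))).
have UyV Y : \sum_j U j *m perm_tensor 1 Y *m V j =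
    d`!%:R^-1 *: \sum_(s : 'S_d) perm_tensor 1 (fun i => avg (Y (s i))).
  rewrite scaler_sumr -(pair_bigA _ (fun s f => U (s, f) *m perm_tensor 1 Y *m V (s, f))).
  apply: eq_bigr => s _ /=; rewrite perm_tensor_sum scaler_sumr.
  apply: eq_bigr => f _; rewrite -!scalemxAl !perm_tensorM /= mulg1 mulgV.
  by congr (_ *: _); apply: eq_perm_tensor => i; rewrite permK.
have UV1 : \sum_j U j *m V j = 1%:M.
  transitivity (\sum_j U j *m perm_tensor 1 (fun=> 1%:M) *m V j).
    by apply: eq_bigr => j _; rewrite perm_tensor1 mulmx1.
  rewrite UyV (eq_bigr (fun=> 1%:M)) => [|s _]; last first.
    rewrite -perm_tensor1; apply: eq_perm_tensor => i.
    by rewrite -[RHS]uv1; apply: eq_bigr => j _; rewrite mulmx1.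
  rewrite sumr_const card_Sn -scaler_nat scalerA mulVf ?scale1r //.
  by rewrite (pchar0_natf_eq0 ch) -lt0n fact_gt0.
(* By polarization the symmetrized tensor is a combination of tensor powers of sums of averages, and
   these sums lie in the centralizer. *)
have comSym (Y : 'I_d -> 'M[F]_n) :
    T *m (\sum_(s : 'S_d) perm_tensor 1 (fun i => avg (Y (s i)))) =
    (\sum_(s : 'S_d) perm_tensor 1 (fun i => avg (Y (s i)))) *m T.
  rewrite (perm_tensor_polarization (fun i => avg (Y i))) mulmx_sumr mulmx_suml.
  apply: eq_bigr => S _; rewrite -scalemxAr -scalemxAl; congr (_ *: _).
  apply: comT => x Ax; rewrite mulmx_sumr mulmx_suml.
  by apply: eq_bigr => i _; rewrite /avg uvC.
(* By linearity [y] may be taken to be a matrix unit, hence an elementary tensor. *)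
have comUV y : T *m (\sum_j U j *m y *m V j) = (\sum_j U j *m y *m V j) *m T.
  have Dy : \sum_j U j *m y *m V j =
      \sum_a \sum_b y a b *: \sum_j U j *m delta_mx a b *m V j.
    rewrite {1}(matrix_sum_delta y).
    under eq_bigr do rewrite mulmx_sumr mulmx_suml.
    rewrite exchange_big; apply: eq_bigr => a _ /=.
    under eq_bigr do rewrite mulmx_sumr mulmx_suml.
    rewrite exchange_big; apply: eq_bigr => b _ /=.
    by rewrite scaler_sumr; apply: eq_bigr => j _; rewrite -scalemxAr -scalemxAl.
  rewrite Dy mulmx_sumr mulmx_suml; apply: eq_bigr => a _.
  rewrite mulmx_sumr mulmx_suml; apply: eq_bigr => b _.
  rewrite -scalemxAr -scalemxAl; congr (_ *: _).
  have [Y ->] : exists Y, delta_mx a b = perm_tensor 1 Y :> 'M[F]_#|{ffun 'I_d -> 'I_n}|.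
    by eexists; apply: delta_perm_tensor.
  by rewrite UyV -scalemxAr -scalemxAl comSym.
have [k ->] := double_commutant_span UV1 comUV.
exists (J * J)%type, (fun j : J * J => k j.1 j.2 * d`!%:R^-1),
  (fun j : J * J => j.1.1 * j.2.1^-1)%g,
  (fun (j : J * J) i => u (j.1.2 i) *m v (j.2.2 ((j.2.1^-1)%g (j.1.1 i)))); split.
  by move=> j i; apply: AM.
rewrite pair_bigA; apply: eq_bigr => -[i j] _ /=.
by rewrite -scalemxAl perm_tensorM scalerA.
Qed.

(** * Traces of permuted tensors as products over cycles *)

Definition ffcons (T : finType) d (y : T) (q : {ffun 'I_d -> T}) : {ffun 'I_d.+1 -> T} :=
  [ffun i => if unlift ord0 i is Some j then q j else y].

Lemma ffcons0 (T : finType) d y (q : {ffun 'I_d -> T}) : ffcons y q ord0 = y.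
Proof. by rewrite ffunE unlift_none. Qed.

Lemma ffconsS (T : finType) d y (q : {ffun 'I_d -> T}) i :
  ffcons y q (lift ord0 i) = q i.
Proof. by rewrite ffunE liftK. Qed.

Lemma sum_ffcons (V : nmodType) (T : finType) d (G : {ffun 'I_d.+1 -> T} -> V) :
  \sum_p G p = \sum_q \sum_y G (ffcons y q).
Proof.
rewrite pair_bigA (reindex (fun t : {ffun 'I_d -> T} * T => ffcons t.2 t.1)) //=.
exists (fun p : {ffun 'I_d.+1 -> T} => ([ffun i => p (lift ord0 i)], p ord0)) => [[q y] _|p _] /=.
  by congr (_, _); [apply/ffunP => i; rewrite ffunE ffconsS | rewrite ffcons0].
apply/ffunP => i; case: (unliftP ord0 i) => [j ->|->]; last by rewrite ffcons0.
by rewrite ffconsS ffunE.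
Qed.

Section TracePoly.
Variables (F : fieldType) (n k : nat) (A : 'M[F]_n -> Prop).

Lemma pure_Atrace_sum (I : Type) (r : seq I) (f : I -> ('I_k -> 'M[F]_n) -> F) :
  (forall i, pure_Atrace_poly A (f i)) ->
  pure_Atrace_poly A (fun x => \sum_(i <- r) f i x).
Proof.
move=> Hf; elim: r => [|i r IH].
  by apply: tp_ext (tp_const _ _ 0) _ => x; rewrite big_nil.
by apply: tp_ext (tp_add (Hf i) IH) _ => x; rewrite big_cons.
Qed.

Lemma pure_Atrace_scale c (f : ('I_k -> 'M[F]_n) -> F) :
  pure_Atrace_poly A f -> pure_Atrace_poly A (fun x => c * f x).
Proof. by move=> Hf; apply: tp_mul Hf; apply: tp_const. Qed.

Lemma Aword_cat (s t : seq ('M[F]_n * 'I_k)) x :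
  Aword (s ++ t) x = Aword s x *m Aword t x.
Proof. by rewrite /Aword map_cat prodmx_cat. Qed.

(* Splitting off or contracting the index [0] of the permutation [s] shortens its cycles, until
   each cycle has become a single trace. *)
Lemma pure_Atrace_cycles d (s : 'I_d -> 'I_d) (w : 'I_d -> seq ('M[F]_n * 'I_k)) :
  injective s -> (forall i p, p \in w i -> A p.1) ->
  pure_Atrace_poly A (fun x =>
    \sum_(p : {ffun 'I_d -> 'I_n}) \prod_i Aword (w i) x (p i) (p (s i))).
Proof.
elim: d s w => [|d IH] s w s_inj Aw.
  apply: tp_ext (tp_const _ _ (\sum_(p : {ffun 'I_0 -> 'I_n}) 1)) _ => x.
  by apply: eq_bigr => p _; rewrite big_ord0.
pose k0 := invF s_inj ord0.
have sk0 : s k0 = ord0 by apply: f_invF.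
(* The map [t] bypasses 0 by sending its preimage [k0] directly to [s ord0]; [s'] is [t] with values
   lowered to ['I_d]. *)
pose t i := if lift ord0 i == k0 then s ord0 else s (lift ord0 i).
have t_neq0 i : ord0 != t i.
  rewrite /t -{1}sk0; have [ik0|ik0] := eqVneq (lift ord0 i) k0; rewrite (inj_eq s_inj).
    by rewrite -ik0 eq_sym neq_lift.
  by rewrite eq_sym.
have /fin_all_exists[s' Es'] i : exists j, t i = lift ord0 j.
  by case: (unlift_some (t_neq0 i)) => j -> _; exists j.
(* Summing over the entry of [p] at 0 multiplies the matrices at [k0] and 0, which concatenates
   their words. *)
pose w' i := if lift ord0 i == k0 then w k0 ++ w ord0 else w (lift ord0 i).
have s'_inj : injective s'.
  move=> i j ij; have : t i = t j by rewrite !Es' ij.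
  rewrite /t; case: (lift ord0 i =P k0) => [ik|_];
    case: (lift ord0 j =P k0) => [jk|_]; [move=> _|..].
  - by apply: (@lift_inj _ ord0); rewrite ik jk.
  - by move/s_inj => /eqP; rewrite (negbTE (neq_lift _ _)).
  - by move/s_inj => /esym/eqP; rewrite (negbTE (neq_lift _ _)).
  - by move/s_inj/lift_inj.
have Aw' i p : p \in w' i -> A p.1.
  by rewrite /w'; case: ifP => _; [rewrite mem_cat => /orP[] |]; apply: Aw.
have IHw := IH s' w' s'_inj Aw'.
(* If 0 is a fixed point of [s], the sum over the entry at 0 splits off the trace of the word
   [w ord0]. *)
have [k00|k0n0] := eqVneq k0 ord0.
  apply: tp_ext (tp_mul (tp_gen (Aw ord0)) IHw) _ => x.
  rewrite sum_ffcons mulr_sumr; apply: eq_bigr => q _.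
  rewrite /mxtrace mulr_suml; apply: eq_bigr => y _.
  rewrite big_ord_recl !ffcons0 -[in s ord0]k00 sk0 ffcons0; congr (_ * _).
  apply: eq_bigr => i _; have ik0 : (lift ord0 i == k0) = false.
    by rewrite k00 eq_sym (negbTE (neq_lift _ _)).
  by rewrite ffconsS -(ffconsS y q (s' i)) -Es' /w' /t ik0.
case: (unliftP ord0 k0) k0n0 => [i0 Ek0 _|->]; last by rewrite eqxx.
apply: tp_ext IHw _ => x.
rewrite sum_ffcons; apply: eq_bigr => q _.
have lift_k0 i : (lift ord0 i == k0) = (i == i0).
  by rewrite Ek0 (inj_eq (@lift_inj _ _)).
rewrite (bigD1 i0) //= {1}/w' lift_k0 eqxx Aword_cat mxE mulr_suml.
apply: eq_bigr => y _.
rewrite big_ord_recl ffcons0 [in RHS](bigD1 i0) //= -Ek0 sk0 ffcons0.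
have -> : ffcons y q (s ord0) = q (s' i0).
  by rewrite -(ffconsS y q (s' i0)) -Es' /t lift_k0 eqxx.
have -> : ffcons y q k0 = q i0 by rewrite Ek0 ffconsS.
rewrite mulrA [X in X * _ = _]mulrC; congr (_ * _).
apply: eq_bigr => i ii0.
by rewrite ffconsS -(ffconsS y q (s' i)) -Es' /w' /t lift_k0 (negbTE ii0).
Qed.

Lemma pure_Atrace_perm_tensor d (s : 'S_d) (w : 'I_d -> seq ('M[F]_n * 'I_k)) :
  (forall i p, p \in w i -> A p.1) ->
  pure_Atrace_poly A (fun x => \tr (perm_tensor s (fun i => Aword (w i) x))).
Proof.
move=> Aw; apply: tp_ext (pure_Atrace_cycles (@perm_inj _ s) Aw) _ => x.
rewrite /mxtrace (reindex (@enum_val _ {ffun 'I_d -> 'I_n})) /=; last first.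
  exact: onW_bij (enum_val_bij _).
by apply: eq_bigr => a _; rewrite mxE.
Qed.

Lemma pure_Atrace_multilinear d (T : 'M[F]_#|{ffun 'I_d -> 'I_n}|) (l : 'I_d -> 'I_k) :
  [pchar F] =i pred0 -> semisimple_subalgebra A ->
  (forall g, in_centralizer_units A g -> forall z : 'I_d -> 'M[F]_n,
     \tr (T *m perm_tensor 1 (fun i => g *m z i *m invmx g)) =
     \tr (T *m perm_tensor 1 z)) ->
  pure_Atrace_poly A (fun x => \tr (T *m perm_tensor 1 (fun i => x (l i)))).
Proof.
move=> ch ssA invT.
have comT : forall g, in_centralizer_units A g ->
    T *m perm_tensor 1 (fun=> g) = perm_tensor 1 (fun=> g) *m T.
  move=> g Bg; have [g_unit _] := Bg.
  have gV : perm_tensor (1 : 'S_d)%g (fun=> g) *m perm_tensor 1 (fun=> invmx g) = 1%:M.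
    rewrite perm_tensorM mulg1 -perm_tensor1.
    by apply: eq_perm_tensor => i; rewrite mulmxV.
  (* Conjugating all the [z i] by [g] amounts, by cyclicity of the trace, to conjugating [T]; the
     trace pairing then turns invariance into commutation. *)
  suff gT : perm_tensor 1 (fun=> invmx g) *m T *m perm_tensor 1 (fun=> g) = T.
    by rewrite -{2}gT 2!mulmxA gV mul1mx.
  apply: eq_of_perm_tensor_trace => z; rewrite -(invT g Bg).
  rewrite -!mulmxA mxtrace_mulC -!mulmxA !perm_tensorM !mulg1.
  by congr (\tr (_ *m _)); apply: eq_perm_tensor => i; rewrite perm1 mulmxA.
have [K [c [s [X [AX ->]]]]] := commute_tensor_span ch ssA (commute_units_commute ch comT).
pose w i j := [:: (X i j, l (s i j))].
have Aw i j p : p \in w i j -> A p.1 by rewrite inE => /eqP->; apply: AX.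
apply: tp_ext (pure_Atrace_sum (index_enum K)
  (fun i => pure_Atrace_scale (c i) (pure_Atrace_perm_tensor (s i) (Aw i)))) _ => x.
rewrite mulmx_suml linear_sum; apply: eq_bigr => i _ /=.
rewrite -scalemxAl linearZ /= perm_tensorM mulg1; congr (_ * \tr _).
by apply: eq_perm_tensor => j; rewrite /Aword /= mulmx1.
Qed.
End TracePoly.

(** * Polarization *)

Section Forms.
Variables (F : fieldType) (n k : nat).
Local Notation M := 'M[F]_n.
Local Notation L := ('I_k * 'I_n * 'I_n)%type.

Definition mx_coord (x : 'I_k -> M) (t : L) : F := x t.1.1 t.1.2 t.2.

(** Indexing the factors of each monomial by ['I_d] builds the degree into the type and lets
    permutations act on the factors. *)
Definition hom_form d (ms : seq (F * ('I_d -> L))) (x : 'I_k -> M) : F :=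
  \sum_(m <- ms) m.1 * \prod_i mx_coord x (m.2 i).

(** The index type is free because both the [k] variables and the [d] arguments of a polarization
    get conjugated. *)
Definition conj_tuple I (g : M) (z : I -> M) (i : I) : M := g *m z i *m invmx g.

Lemma polyfun_monomials (f : ('I_k -> M) -> F) : polyfun f ->
  exists ms : seq (F * seq L),
    forall x, f x = \sum_(m <- ms) m.1 * \prod_(t <- m.2) mx_coord x t.
Proof.
elim=> [c|l i j|g h _ [ms Dg] _ [ms' Dh]|g h _ [ms Dg] _ [ms' Dh]|g h _ [ms Dg] gh].
- by exists [:: (c, [::])] => x; rewrite big_seq1 big_nil mulr1.
- by exists [:: (1, [:: (l, i, j)])] => x; rewrite !big_seq1 mul1r.
- by exists (ms ++ ms') => x; rewrite big_cat Dg Dh.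
- exists [seq (m.1 * m'.1, m.2 ++ m'.2) | m <- ms, m' <- ms'] => x.
  rewrite Dg Dh big_allpairs_dep mulr_suml; apply: eq_bigr => m _.
  by rewrite mulr_sumr; apply: eq_bigr => m' _; rewrite big_cat mulrACA.
- by exists ms => x; rewrite -gh.
Qed.

Lemma homogeneous_component (ms : seq (F * seq L)) d :
  exists ms' : seq (F * ('I_d -> L)), forall x,
    hom_form ms' x = \sum_(m <- ms | size m.2 == d) m.1 * \prod_(t <- m.2) mx_coord x t.
Proof.
elim: ms => [|[c s] ms [ms' IH]]; first by exists [::] => x; rewrite /hom_form !big_nil.
have [sd|nsd] := eqVneq (size s) d; last first.
  by exists ms' => x; rewrite big_cons /= (negbTE nsd).
subst d; exists ((c, tnth (in_tuple s)) :: ms') => x.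
by rewrite /hom_form !big_cons eqxx -IH /= (big_tnth _ _ s).
Qed.

Lemma polyfun_homogeneous (f : ('I_k -> M) -> F) : polyfun f ->
  exists N (ms : forall d : 'I_N, seq (F * ('I_d -> L))), forall x t,
    f (fun l => t *: x l) = \sum_(d < N) t ^+ d * hom_form (ms d) x.
Proof.
move=> /polyfun_monomials[ms Df].
pose N := (\max_(m <- ms) size m.2).+1.
have [ms' Dms'] := fin_all_exists (fun d : 'I_N => homogeneous_component ms d).
exists N, ms' => x t; rewrite Df.
under [RHS]eq_bigr do rewrite Dms' big_mkcond mulr_sumr.
rewrite exchange_big big_seq [RHS]big_seq; apply: eq_bigr => m m_ms /=.
have szm : (size m.2 < N)%N.
  by rewrite ltnS; apply: (leq_bigmax_seq (F := fun m => size m.2)).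
rewrite (bigD1 (Ordinal szm)) //= eqxx [X in _ + X]big1 ?addr0 => [|d /negbTE nd]; last first.
  by rewrite -[size m.2]/(val (Ordinal szm)) eq_sym (inj_eq val_inj) nd mulr0.
rewrite mulrCA; congr (_ * _).
elim: m.2 => [|u s IH] /=; first by rewrite !big_nil mulr1.
by rewrite !big_cons IH exprS mulrACA /mx_coord mxE.
Qed.

Section Polarize.
Variables (d : nat) (ms : seq (F * ('I_d -> L))).

(** Argument [z j] is fed to the variable [l j], and the signed sum over [S] extracts the part
    multilinear in [z]. Being a combination of values of the form, it inherits conjugation
    invariance directly. *)
Definition polarization (l : 'I_d -> 'I_k) (z : 'I_d -> M) : F :=
  \sum_(S : {set 'I_d}) (-1) ^+ #|~: S| *
    hom_form ms (fun l' => \sum_(j in S | l j == l') z j).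

Lemma polarizationE l z : polarization l z =
  \sum_(m <- ms) m.1 * \sum_(s : 'S_d) \prod_i
    ((l (s i) == (m.2 i).1.1)%:R * z (s i) (m.2 i).1.2 (m.2 i).2).
Proof.
under [RHS]eq_bigr => m _.
  rewrite (permanent_ryser (fun i j => (l j == (m.2 i).1.1)%:R * z j _ _)) mulr_sumr.
over.
rewrite exchange_big; apply: eq_bigr => S _ /=.
rewrite /hom_form mulr_sumr; apply: eq_bigr => m _.
rewrite mulrCA; congr (_ * (_ * _)); apply: eq_bigr => i _.
rewrite /mx_coord summxE big_mkcondr; apply: eq_bigr => j _ /=.
by case: eqP; rewrite ?mul1r ?mul0r ?mxE.
Qed.

Lemma polarization_restitution x :
  \sum_(l : {ffun 'I_d -> 'I_k}) polarization l (x \o l) = d`!%:R * hom_form ms x.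
Proof.
under eq_bigr do rewrite polarizationE.
rewrite exchange_big /hom_form mulr_sumr; apply: eq_bigr => m _ /=.
rewrite -mulr_sumr exchange_big mulrCA; congr (_ * _) => /=.
rewrite -card_Sn mulr_natl -sumr_const; apply: eq_bigr => s _.
(* For a given monomial and permutation [s], only the assignment [l0] matching the variables of the
   monomial survives; each monomial is thus counted once per permutation. *)
pose l0 : {ffun 'I_d -> 'I_k} := [ffun j => (m.2 ((s^-1)%g j)).1.1].
rewrite (bigD1 l0) //= [X in _ + X]big1 ?addr0 => [|l ll0].
  by apply: eq_bigr => i _; rewrite ffunE permK eqxx mul1r.
have [i ni|eq_l] := pickP (fun i => l (s i) != (m.2 i).1.1).
  by rewrite (bigD1 i) //= (negbTE ni) !mul0r.
case/eqP: ll0; apply/ffunP => j; rewrite ffunE.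
by have /negbFE/eqP := eq_l ((s^-1)%g j); rewrite permKV.
Qed.

Lemma polarization_conj l g z :
  (forall x, hom_form ms (conj_tuple g x) = hom_form ms x) ->
  polarization l (conj_tuple g z) = polarization l z.
Proof.
move=> inv; apply: eq_bigr => S _; congr (_ * _); rewrite -[RHS]inv.
apply: eq_bigr => m _; congr (_ * _); apply: eq_bigr => i _.
by rewrite /mx_coord /conj_tuple mulmx_sumr mulmx_suml.
Qed.

Lemma polarization_tensor l :
  exists T : 'M[F]_#|{ffun 'I_d -> 'I_n}|,
    forall z, polarization l z = \tr (T *m perm_tensor 1 z).
Proof.
have monomial (m : F * ('I_d -> L)) (s : 'S_d) :
    exists T : 'M[F]_#|{ffun 'I_d -> 'I_n}|, forall z : 'I_d -> M,
    \prod_i ((l (s i) == (m.2 i).1.1)%:R * z (s i) (m.2 i).1.2 (m.2 i).2) =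
      \tr (T *m perm_tensor 1 z).
  (* The product of entries of [z] is the entry [(a, b)] of [perm_tensor 1 z], the factor with index
     [s^-1 j] supplying the row and column for [z j]. *)
  pose a := enum_rank [ffun j => (m.2 ((s^-1)%g j)).1.2].
  pose b := enum_rank [ffun j => (m.2 ((s^-1)%g j)).2].
  exists ((\prod_i (l (s i) == (m.2 i).1.1)%:R) *: delta_mx b a) => z.
  rewrite -scalemxAl linearZ /= mxtrace_mulC tr_mul_delta mxE big_split /=.
  congr (_ * _); rewrite [RHS](reindex_inj (@perm_inj _ s)).
  by apply: eq_bigr => i _; rewrite perm1 !enum_rankK !ffunE permK.
have perm_sum m : exists T : 'M[F]_#|{ffun 'I_d -> 'I_n}|, forall z : 'I_d -> M,
    m.1 * \sum_(s : 'S_d) \prod_i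
      ((l (s i) == (m.2 i).1.1)%:R * z (s i) (m.2 i).1.2 (m.2 i).2) =
    \tr (T *m perm_tensor 1 z).
  have [T DT] := fin_all_exists (monomial m).
  exists (m.1 *: \sum_s T s) => z; rewrite -scalemxAl linearZ /=; congr (_ * _).
  by rewrite mulmx_suml linear_sum; apply: eq_bigr => s _; rewrite DT.
suff [T DT] : exists T : 'M[F]_#|{ffun 'I_d -> 'I_n}|, forall z : 'I_d -> M,
    \sum_(m <- ms) m.1 * \sum_(s : 'S_d) \prod_i
      ((l (s i) == (m.2 i).1.1)%:R * z (s i) (m.2 i).1.2 (m.2 i).2) =
    \tr (T *m perm_tensor 1 z).
  by exists T => z; rewrite polarizationE DT.
elim: ms => [|m ms' [T IH]].
  by exists 0 => z; rewrite big_nil mul0mx linear0.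
have [T' DT'] := perm_sum m.
by exists (T' + T) => z; rewrite big_cons DT' IH mulmxDl linearD.
Qed.
End Polarize.

(** Conjugation commutes with scaling by [t], so the forms are coefficients of two polynomials in
    [t] that agree at every point. *)
Lemma form_conj_invariant N (ms : forall d : 'I_N, seq (F * ('I_d -> L)))
    (f : ('I_k -> M) -> F) (g : M) :
  [pchar F] =i pred0 ->
  (forall x t, f (fun l => t *: x l) = \sum_(d < N) t ^+ d * hom_form (ms d) x) ->
  (forall x, f (conj_tuple g x) = f x) ->
  (forall x y, (forall l, x l = y l) -> f x = f y) ->
  forall d x, hom_form (ms d) (conj_tuple g x) = hom_form (ms d) x.
Proof.
move=> ch fE f_inv f_ext d x.
pose p y := \poly_(i < N) (if insub i is Some d' then hom_form (ms d') y else 0).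
have pE y t : (p y).[t] = f (fun l => t *: y l).
  rewrite fE horner_poly; apply: eq_bigr => i _.
  by rewrite valK mulrC.
have /polyP/(_ d) : p (conj_tuple g x) = p x.
  apply/eqP; rewrite -subr_eq0; apply/eqP/(pchar0_poly_eq0 ch) => t.
  rewrite hornerD hornerN !pE -(f_inv (fun l => t *: x l)); apply/eqP.
  rewrite subr_eq0; apply/eqP/f_ext => l.
  by rewrite /conj_tuple -scalemxAr -scalemxAl.
by rewrite !coef_poly ltn_ord valK.
Qed.

End Forms.

Theorem theorem5p2 (F : fieldType) (n k : nat) (A : 'M[F]_n -> Prop)
    (f : ('I_k -> 'M[F]_n) -> F) :
  [pchar F] =i pred0 ->
  semisimple_subalgebra A ->
  polyfun f ->
  (forall g : 'M[F]_n, in_centralizer_units A g ->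
     forall x : 'I_k -> 'M[F]_n,
       f (fun l => g *m x l *m invmx g) = f x) ->
  pure_Atrace_poly A f.
Proof.
move=> ch ssA pf f_inv.
have [N [ms fE]] := polyfun_homogeneous pf.
(* A polynomial function depends only on the matrix entries, so this extensionality needs no
   axiom. *)
have f_ext : forall x y, (forall l, x l = y l) -> f x = f y.
  have [ms' Df] := polyfun_monomials pf; move=> x y xy; rewrite !Df.
  apply: eq_bigr => m _; congr (_ * _); apply: eq_bigr => t _.
  by rewrite /mx_coord xy.
suff form_pure d : pure_Atrace_poly A (hom_form (ms d)).
  apply: tp_ext (pure_Atrace_sum (index_enum 'I_N) form_pure) _ => x /=.
  rewrite -[RHS](f_ext (fun l => 1 *: x l)) => [|l]; last by rewrite scale1r.
  by rewrite fE; apply: eq_bigr => i _; rewrite expr1n mul1r.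
have polarization_pure l :
    pure_Atrace_poly A (fun x => polarization (ms d) l (x \o l)).
  have [T DT] := polarization_tensor (ms d) l.
  apply: tp_ext (pure_Atrace_multilinear (T := T) l ch ssA _) _ => [g Bg z|x].
    rewrite -!DT; apply: polarization_conj.
    exact: (form_conj_invariant ch fE (f_inv g Bg) f_ext).
  by rewrite DT.
(* Restitution recovers the form up to the factor [d!], which is invertible in characteristic
   zero. *)
apply: tp_ext (pure_Atrace_scale (d`!%:R^-1)
  (pure_Atrace_sum (index_enum {ffun 'I_d -> 'I_k})
    (fun l : {ffun 'I_d -> 'I_k} => polarization_pure l))) _ => x /=.
rewrite polarization_restitution mulKf //.
by rewrite (pchar0_natf_eq0 ch) -lt0n fact_gt0.
Qed.
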